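(* Let $\prec$ be an exposure order on $F$ and let $I$ be a right ideal in $\mathcal{A}=K[F]$. Then the set of Schreier transversals for $I$ admits a minimum $T_{I,\prec}$ with respect to the order $\prec_{\min}$; that is, there is a Schreier transversal $T_{I,\prec}$ for $I$ such that $T_{I,\prec}\preceq_{\min}T$ for every Schreier transversal $T$ for $I$.
   Context: $K$ is a field, $F$ is a free group with finite basis $S$ (elements are identified with reduced words in $S\cup S^{-1}$; $e$ is the identity, i.e. the empty word), and $\mathcal{A}=K[F]$ is the group algebra. For $T\subseteq F$, $\mathrm{Sp}_K(T)$ denotes the $K$-linear span of $T$ in $\mathcal{A}$. An exposure order on $F$ is a well-order $\prec$ on $F$ such that $u\preceq v$ whenever $u$ is a prefix of $v$. A subset of $F$ is prefix-closed if it contains every prefix of each of its elements. A Schreier transversal for a right ideal $I\le\mathcal{A}$ is a prefix-closed subset $T\subseteq F$ such that $\mathrm{Sp}_K(T)\cap I=\{0\}$ and every $I$-coset $f+I$ ($f\in\mathcal{A}$) intersects $\mathrm{Sp}_K(T)$. For distinct subsets $A,B\subseteq F$, write $A\prec_{\min}B$ if $\min(A\triangle B)\in A$, where $\triangle$ is the symmetric difference and the minimum is taken with respect to $\prec$. This is a total order on subsets of $F$. *)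

(* Defs.v *)
From HB Require Import structures.
From mathcomp Require Import all_boot all_order all_algebra.
From mathcomp Require Import finmap.
From mathcomp Require Import boolp classical_sets wochoice.
From mathcomp.multinomials Require Import monalg.

Set Implicit Arguments.
Unset Strict Implicit.
Unset Printing Implicit Defensive.

Import GRing.Theory.

Local Open Scope classical_set_scope.
Local Open Scope ring_scope.

Section FreeGroup.
Variable S : choiceType.

(* (s, false) stands for the generator s and (s, true) for its inverse. *)
Definition letter : Type := (S * bool)%type.

Definition inv_letter (a : letter) : letter := (a.1, ~~ a.2).

Definition reduced (w : seq letter) : bool :=
  sorted (fun a b => b != inv_letter a) w.

Record free_group : Type := FreeGroup {
  fg_word :> seq letter;
  fg_reduced : reduced fg_word
}.

HB.instance Definition _ := [isSub for fg_word].
HB.instance Definition _ := [Choice of free_group by <:].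

(* Left multiplication of a reduced word by one letter, with cancellation. *)
Definition push_letter (a : letter) (w : seq letter) : seq letter :=
  if w is b :: w' then if b == inv_letter a then w' else a :: w else [:: a].

Definition word_mul (v w : seq letter) : seq letter := foldr push_letter w v.

Definition word_inv (w : seq letter) : seq letter := rev (map inv_letter w).

Lemma inv_letterK : involutive inv_letter.
Proof. by case=> s b; rewrite /inv_letter /= negbK. Qed.

Lemma reduced_push a w : reduced w -> reduced (push_letter a w).
Proof.
case: w => [//|b w] /= rw; case: ifP => [_|nba]; first exact: path_sorted rw.
by rewrite /= nba.
Qed.

Lemma reduced_mul v w : reduced w -> reduced (word_mul v w).
Proof. by move=> rw; elim: v => //= a v; apply: reduced_push. Qed.

Lemma reduced_inv w : reduced w -> reduced (word_inv w).
Proof.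
rewrite /reduced /word_inv rev_sorted sorted_map.
apply: sub_sorted => a b /=.
by rewrite (inj_eq (inv_inj inv_letterK)) eq_sym -(can2_eq inv_letterK inv_letterK) eq_sym.
Qed.

Lemma push_letterK a w :
  reduced w -> push_letter (inv_letter a) (push_letter a w) = w.
Proof.
case: w => [|b w] /= rw; first by rewrite inv_letterK eqxx.
case: ifP => [/eqP eba|nba] /=; last by rewrite inv_letterK eqxx.
case: w rw => [|c w] /=; first by rewrite eba.
by rewrite eba => /andP[/negbTE->].
Qed.

Lemma push_mul a v w : reduced v -> reduced w ->
  word_mul (push_letter a v) w = push_letter a (word_mul v w).
Proof.
case: v => [//|b v] /= rv rw; case: ifP => [/eqP->|_] //=.
rewrite -{1}[a]inv_letterK push_letterK //; exact: reduced_mul.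
Qed.

Lemma word_mulA u v w : reduced v -> reduced w ->
  word_mul u (word_mul v w) = word_mul (word_mul u v) w.
Proof.
move=> rv rw; elim: u => //= a u ->; rewrite push_mul //; exact: reduced_mul.
Qed.

Lemma word_mul1 w : reduced w -> word_mul w [::] = w.
Proof.
elim: w => //= a w IHw rw; rewrite (IHw (path_sorted rw)).
by case: w rw {IHw} => //= b w /andP[/negbTE->].
Qed.

Lemma word_mulV w : reduced w -> word_mul (word_inv w) w = [::].
Proof.
elim: w => //= a w IHw rw.
rewrite /word_inv /= rev_cons /word_mul foldr_rcons /= inv_letterK eqxx.
exact: IHw (path_sorted rw).
Qed.

Lemma word_invK : involutive word_inv.
Proof.
by move=> w; rewrite /word_inv map_rev revK -map_comp map_id_in // => a _; exact: inv_letterK.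
Qed.

Definition fg_one : free_group := @FreeGroup [::] isT.

Definition fg_mul (u v : free_group) : free_group :=
  FreeGroup (reduced_mul u (fg_reduced v)).

Definition fg_inv (u : free_group) : free_group :=
  FreeGroup (reduced_inv (fg_reduced u)).

Lemma fg_mulA : associative fg_mul.
Proof. by move=> u v w; apply: val_inj; apply: word_mulA; exact: fg_reduced. Qed.

Lemma fg_mul1g : left_id fg_one fg_mul.
Proof. by move=> u; apply: val_inj. Qed.

Lemma fg_mulg1 : right_id fg_one fg_mul.
Proof. by move=> u; apply: val_inj; apply: word_mul1; exact: fg_reduced. Qed.

Lemma fg_mulVg : left_inverse fg_one fg_inv fg_mul.
Proof. by move=> u; apply: val_inj; apply: word_mulV; exact: fg_reduced. Qed.

Lemma fg_mulgV : right_inverse fg_one fg_inv fg_mul.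
Proof.
move=> u; apply: val_inj => /=; rewrite -{1}[val u]word_invK.
exact: word_mulV (reduced_inv (fg_reduced u)).
Qed.

HB.instance Definition _ := isGroup.Build free_group
  fg_mulA fg_mul1g fg_mulg1 fg_mulVg fg_mulgV.

End FreeGroup.

(* The library only makes {malg K[G]} a ring when G is a monoid without
   nontrivial units, hence the alias carrying its own product. *)
Definition group_algebra (K : fieldType) (G : groupType) : Type := {malg K[G]}.

Section GroupAlgebra.
Variables (K : fieldType) (G : groupType).
Local Notation A := (group_algebra K G).

HB.instance Definition _ := GRing.Lmodule.copy A {malg K[G]}.

Definition ga_of (u : G) : A := << u >>.

Definition ga_mul (f g : A) : A :=
  \sum_(u <- msupp f) \sum_(v <- msupp g) << f@_u * g@_v *g (u * v)%g >>.

Lemma ga_mulEw (d1 d2 : {fset G}) (f g : A) :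
  (msupp f `<=` d1)%fset -> (msupp g `<=` d2)%fset ->
  ga_mul f g = \sum_(u <- d1) \sum_(v <- d2) << f@_u * g@_v *g (u * v)%g >>.
Proof.
move=> le1 le2; rewrite /ga_mul (big_fset_incl _ le1) /=; last first.
  move=> u _ /mcoeff_outdom fu; rewrite big1 // => v _.
  by rewrite fu mul0r monalgU0.
apply: eq_bigr => u _; apply: big_fset_incl => // v _ /mcoeff_outdom ->.
by rewrite mulr0 monalgU0.
Qed.

Lemma ga_mulDl : left_distributive ga_mul +%R.
Proof.
move=> f1 f2 g; set d := (msupp f1 `|` msupp f2)%fset.
rewrite (@ga_mulEw d _ _ _ (msuppD_le f1 f2) (fsubset_refl _)).
rewrite (@ga_mulEw d _ f1 _ (fsubsetUl _ _) (fsubset_refl _)).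
rewrite (@ga_mulEw d _ f2 _ (fsubsetUr _ _) (fsubset_refl _)).
rewrite -big_split /=; apply: eq_bigr => u _.
rewrite -big_split /=; apply: eq_bigr => v _.
by rewrite mcoeffD mulrDl monalgUD.
Qed.

Lemma ga_mulDr : right_distributive ga_mul +%R.
Proof.
move=> g f1 f2; set d := (msupp f1 `|` msupp f2)%fset.
rewrite (@ga_mulEw _ d _ _ (fsubset_refl _) (msuppD_le f1 f2)).
rewrite (@ga_mulEw _ d _ f1 (fsubset_refl _) (fsubsetUl _ _)).
rewrite (@ga_mulEw _ d _ f2 (fsubset_refl _) (fsubsetUr _ _)).
rewrite -big_split /=; apply: eq_bigr => u _.
rewrite -big_split /=; apply: eq_bigr => v _.
by rewrite mcoeffD mulrDr monalgUD.
Qed.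

Lemma ga_mul0g : left_zero 0 ga_mul.
Proof. by move=> g; rewrite /ga_mul msupp0 big_seq_fset0. Qed.

Lemma ga_mulg0 : right_zero 0 ga_mul.
Proof.
by move=> g; rewrite /ga_mul big1 // => u _; rewrite msupp0 big_seq_fset0.
Qed.

Lemma ga_mulUU (c1 c2 : K) (u1 u2 : G) :
  ga_mul << c1 *g u1 >> << c2 *g u2 >> = << c1 * c2 *g (u1 * u2)%g >>.
Proof. by rewrite (ga_mulEw msuppU_le msuppU_le) !big_seq_fset1 !mcoeffUU. Qed.

Lemma ga_mul_suml (I : Type) (r : seq I) (F : I -> A) (g : A) :
  ga_mul (\sum_(i <- r) F i) g = \sum_(i <- r) ga_mul (F i) g.
Proof.
exact: (big_morph (ga_mul^~ g) (fun _ _ => ga_mulDl _ _ _) (ga_mul0g _)).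
Qed.

Lemma ga_mul_sumr (I : Type) (r : seq I) (F : I -> A) (g : A) :
  ga_mul g (\sum_(i <- r) F i) = \sum_(i <- r) ga_mul g (F i).
Proof.
exact: (big_morph (ga_mul g) (fun _ _ => ga_mulDr _ _ _) (ga_mulg0 _)).
Qed.

Lemma ga_mulEl (f g : A) :
  ga_mul f g = \sum_(u <- msupp f) ga_mul << f@_u *g u >> g.
Proof. by rewrite -ga_mul_suml -monalgE. Qed.

Lemma ga_mulEr (f g : A) :
  ga_mul f g = \sum_(u <- msupp g) ga_mul f << g@_u *g u >>.
Proof. by rewrite -ga_mul_sumr -monalgE. Qed.

Lemma ga_mulA : associative ga_mul.
Proof.
move=> f g h; rewrite (ga_mulEl f (ga_mul g h)) (ga_mulEl f g) ga_mul_suml.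
apply: eq_bigr => u _.
rewrite (ga_mulEl g h) ga_mul_sumr (ga_mulEr _ g) ga_mul_suml.
apply: eq_bigr => v _.
rewrite (ga_mulEr _ h) ga_mul_sumr (ga_mulEr _ h).
by apply: eq_bigr => w _; rewrite !ga_mulUU mulrA mulgA.
Qed.

Lemma ga_mul1g : left_id (ga_of 1%g) ga_mul.
Proof.
move=> g; rewrite ga_mulEr [RHS]monalgE; apply: eq_bigr => u _.
by rewrite ga_mulUU mul1r mul1g.
Qed.

Lemma ga_mulg1 : right_id (ga_of 1%g) ga_mul.
Proof.
move=> g; rewrite ga_mulEl [RHS]monalgE; apply: eq_bigr => u _.
by rewrite ga_mulUU mulr1 mulg1.
Qed.

Lemma ga_one_neq0 : ga_of 1%g != 0.
Proof. by rewrite monalgU_eq0 oner_eq0. Qed.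

HB.instance Definition _ := GRing.Zmodule_isNzRing.Build A
  ga_mulA ga_mul1g ga_mulg1 ga_mulDl ga_mulDr ga_one_neq0.

Lemma ga_scaleEl (c : K) (f : A) : c *: f = (<< c *g 1%g >> : A) * f.
Proof.
rewrite [RHS]ga_mulEr; apply: eq_bigr => u _.
by rewrite ga_mulUU mul1g.
Qed.

Lemma ga_scaleEr (c : K) (f : A) : c *: f = f * (<< c *g 1%g >> : A).
Proof.
rewrite [RHS]ga_mulEl; apply: eq_bigr => u _.
by rewrite ga_mulUU mulg1 mulrC.
Qed.

Lemma ga_scaleAl (c : K) (f g : A) : c *: (f * g) = (c *: f) * g.
Proof. by rewrite !ga_scaleEl mulrA. Qed.

Lemma ga_scaleAr (c : K) (f g : A) : c *: (f * g) = f * (c *: g).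
Proof. by rewrite !ga_scaleEr mulrA. Qed.

HB.instance Definition _ := GRing.Lmodule_isLalgebra.Build K A ga_scaleAl.
HB.instance Definition _ := GRing.Lalgebra_isAlgebra.Build K A ga_scaleAr.

Definition Sp (T : set G) : set A :=
  [set f | exists2 s : seq (K * G), (forall p, p \in s -> T p.2) &
           f = \sum_(p <- s) p.1 *: ga_of p.2].

End GroupAlgebra.

(* The library's ideals are proper, which is not assumed here. *)
Definition right_ideal (R : nzRingType) (I : set R) : Prop :=
  [/\ I 0, forall f g, I f -> I g -> I (f - g) & forall f a, I f -> I (f * a)].

Section Transversals.
Variable S : choiceType.
Local Notation F := (free_group S).

Definition prefix_closed (T : set F) : Prop :=
  forall u v : F, T v -> prefix u v -> T u.

Definition schreier_transversal (K : fieldType)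
    (I : set (group_algebra K F)) (T : set F) : Prop :=
  [/\ prefix_closed T,
      Sp T `&` I = [set 0] &
      forall f, [set f + g | g in I] `&` Sp T !=set0].

(* le is the reflexive order; well_order makes it a total order. *)
Definition exposure_order (le : rel F) : Prop :=
  well_order le /\ forall u v : F, prefix u v -> le u v.

Definition lt_min (le : rel F) (A B : set F) : Prop :=
  exists2 m, minimum_of le [mem A `+` B] m & A m.

Definition le_min (le : rel F) (A B : set F) : Prop := A = B \/ lt_min le A B.

End Transversals.

(* Main.v *)
(** The minimum is the greedy transversal: run through [F] along [le] and keep
    a word [w] when all its proper prefixes have been kept and [w] is not in
    [Sp (kept words below w) + I].  The kept set [T] is independent modulo [I]
    (look at the largest word in the support of an element of [Sp T `&` I]).
    It spans because [Sp T + I] contains [1] and is stable under right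
    multiplication by a letter [a]: for [t] in [T], the word [t * a] is either a
    prefix of [t], hence in [T], or a child of [t], for which rejection can only
    mean that it lies in [Sp T + I].  If [U] is another Schreier transversal and
    [m] is the least word where [T] and [U] differ, then [T] and [U] agree below
    [m]; so [m] in [U] would have been kept, since otherwise [U] would be
    dependent modulo [I]. *)
Require Import Defs.
From mathcomp Require Import all_boot all_order all_algebra.
From mathcomp Require Import finmap.
From mathcomp Require Import boolp classical_sets wochoice.
From mathcomp.multinomials Require Import monalg.

Set Implicit Arguments.
Unset Strict Implicit.
Unset Printing Implicit Defensive.

Import GRing.Theory.

(** * Order properties that follow from every nonempty set having a least element *)

Section WellOrder.
Variables (T : eqType) (R : rel T).
Hypothesis wo : well_order R.

Lemma well_order_total : total R.
Proof.
move=> x y; apply: (@wo_chainW T R predT) => //.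
exact: withinW.
Qed.

Lemma well_order_anti : antisymmetric R.
Proof.
move=> x y; apply: (@wo_chain_antisymmetric T R predT) => //.
exact: withinW.
Qed.

(** Consider the least element of [[:: x; y; z]]. If it is [x] the claim is immediate; if it is [y]
    or [z], antisymmetry identifies [x] with [y] or [y] with [z]. *)
Lemma well_order_trans : transitive R.
Proof.
move=> y x z xy yz.
have [|m [[m_in lb] _]] := wo (A := mem [:: x; y; z]).
  by exists x; exact: mem_head.
have [mx my mz] : [/\ R m x, R m y & R m z].
  by split; apply: lb; rewrite !inE eqxx ?orbT.
move: m_in; rewrite !inE => /or3P[] /eqP em; rewrite em in mx my mz => //.
  by rewrite (well_order_anti (introT andP (conj xy mx))).
by rewrite -(well_order_anti (introT andP (conj yz my))).
Qed.

(** Everything strictly below a least inaccessible element would be accessible, and so would that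
    element. *)
Lemma well_order_wf : well_founded (fun x y => R x y && (x != y)).
Proof.
move=> x; apply: contrapT => nx.
have [|m [[nm lb] _]] := wo (A := mem [pred y | `[< ~ Acc (fun x y => R x y && (x != y)) y >]]).
  by exists x; apply/asboolP.
move/asboolP: nm; apply; constructor=> y /andP[ym neq].
apply: contrapT => ny; case/negP: neq; apply/eqP/well_order_anti.
by rewrite ym lb //; apply/asboolP.
Qed.

Lemma well_order_max (s : seq T) :
  s != [::] -> exists2 m, m \in s & {in s, forall x, R x m}.
Proof.
elim: s => // x s IH _; case: (eqVneq s [::]) => [->|/IH[m ms mP]].
  exists x; rewrite ?mem_head // => y; rewrite inE => /eqP->.
  by have := well_order_total x x; rewrite orbb.
have /orP[xm|mx] := well_order_total x m.
  by exists m; rewrite ?inE ?ms ?orbT // => y /predU1P[->|/mP].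
exists x; rewrite ?mem_head // => y /predU1P[->|/mP ym].
  by have := well_order_total x x; rewrite orbb.
exact: well_order_trans mx.
Qed.

End WellOrder.

Local Open Scope classical_set_scope.

(** Well-founded recursion with values in [Prop]: membership of [w] may refer to the part of the set
    already decided below [w]. *)
Lemma wf_rec_set (T : Type) (R : T -> T -> Prop) (P : T -> set T -> Prop) :
  well_founded R ->
  exists A : set T, forall w, A w <-> P w (A `&` [set v | R v w]).
Proof.
move=> wfR.
pose step w (rec : forall v, R v w -> Prop) :=
  P w [set v | exists r : R v w, rec v r].
exists (Fix wfR (fun=> Prop) step) => w.
rewrite Fix_eq /step.
  suff -> : [set v | exists _ : R v w, Fix wfR (fun=> Prop) step v] =
            Fix wfR (fun=> Prop) step `&` [set v | R v w] by [].
  by apply/seteqP; split=> v /= [].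
move=> v f g fg; congr (P v _); apply/seteqP.
by split=> x /= [r]; [rewrite fg | rewrite -fg]; exists r.
Qed.

(** * Right multiplication of reduced words by one letter *)

Section FreeGroupLetters.
Variable S : choiceType.
Local Notation F := (free_group S).

Lemma word_mul_cat (v w : seq (letter S)) :
  reduced (v ++ w) -> word_mul v w = v ++ w.
Proof.
elim: v => //= a v IH rvw; rewrite IH; last exact: path_sorted rvw.
by move: rvw; case: (v ++ w) => //= b x /andP[/negbTE->].
Qed.

Definition fg_letter (a : letter S) : F := @FreeGroup S [:: a] isT.

Lemma prefix_rcons_cases (T : eqType) (v u : seq T) (a : T) :
  prefix v (rcons u a) -> v != rcons u a -> prefix v u.
Proof.
case/prefixP=> w; case/lastP: w => [|w b].
  by rewrite cats0 => ->; rewrite eqxx.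
by rewrite -rcons_cat => /rcons_inj[-> _] _; exact: prefix_prefix.
Qed.

(** The letter either cancels the last letter of [u] or is appended. *)
Lemma fg_mul_letter (u : F) (a : letter S) :
  prefix (u * fg_letter a)%g u \/ (u * fg_letter a)%g = rcons u a :> seq _.
Proof.
case: u => u ru; rewrite [fg_word _]/=.
case/lastP: u ru => [|u b] ru; first by right.
have [eab|nab] := eqVneq a (inv_letter b); [left|right].
  rewrite /word_mul foldr_rcons /= eab eqxx.
  have ru' : reduced u by move: ru; rewrite /reduced -cats1 => /cat_sorted2[].
  by rewrite -[foldr _ _ _]/(word_mul u [::]) word_mul1 // prefix_rcons.
rewrite /= -[RHS]cats1; apply: word_mul_cat; move: ru.
rewrite /reduced -!cats1 -catA; case: u => [|c u] /=.
  by rewrite nab.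
by rewrite !cat_path /= nab andbT.
Qed.

Lemma fg_rcons (u : F) (w : seq (letter S)) (a : letter S) :
  fg_word u = rcons w a -> exists v : F, fg_word v = w /\ u = (v * fg_letter a)%g.
Proof.
case: u => u ru /= eu; subst u.
have rw : reduced w by move: ru; rewrite /reduced -cats1 => /cat_sorted2[].
exists (FreeGroup rw); split=> //; apply: val_inj => /=.
by rewrite -cats1 word_mul_cat // cats1.
Qed.

Lemma fg_right_ind (P : F -> Prop) :
  P 1%g -> (forall u a, P u -> P (u * fg_letter a)%g) -> forall u, P u.
Proof.
move=> P1 PM u; move: {-1}(fg_word u) (erefl (fg_word u)) => w.
elim/last_ind: w u => [|w a IH] u eu.
  by have -> : u = 1%g by apply: val_inj.
by have [v [ev ->]] := fg_rcons eu; apply/PM/IH.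
Qed.

End FreeGroupLetters.

Local Open Scope ring_scope.

(** * Spans, and spans modulo a right ideal *)

Section Span.
Variables (K : fieldType) (G : groupType).
Local Notation A := (group_algebra K G).

Lemma SpP (T : set G) (f : A) : Sp T f <-> forall u, f@_u != 0 -> T u.
Proof.
split=> [[s sT ->] u|fT].
  elim: s sT => [|p s IH] sT; first by rewrite big_nil mcoeff0 eqxx.
  rewrite big_cons mcoeffD mcoeffZ mcoeffU.
  have [<- _|_] := eqVneq p.2 u; first exact/sT/mem_head.
  rewrite mulr0n mulr0 add0r; apply: IH => q qs; apply: sT.
  by rewrite inE qs orbT.
exists [seq (f@_u, u) | u <- msupp f].
  by move=> p /mapP[u uf ->]; apply: fT; rewrite mcoeff_neq0.
rewrite big_map {1}[f]monalgE; apply: eq_bigr => u _ /=.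
by apply/malgP => v; rewrite mcoeffZ !mcoeffU mulr_natr.
Qed.

Lemma sub_Sp (T U : set G) : (T `<=` U)%classic -> (Sp T `<=` (Sp U : set A))%classic.
Proof. by move=> TU f [s sT ->]; exists s => // p /sT/TU. Qed.

Lemma Sp_ga_of (T : set G) u : T u -> Sp T (ga_of K u).
Proof.
move=> Tu; apply/SpP => v; rewrite mcoeffU.
by have [<-|] := eqVneq u v; rewrite ?mulr0n ?eqxx.
Qed.

Lemma Sp0 (T : set G) : Sp T (0 : A).
Proof. by apply/SpP => u; rewrite mcoeff0 eqxx. Qed.

Lemma SpD (T : set G) (f g : A) : Sp T f -> Sp T g -> Sp T (f + g).
Proof.
move=> /SpP fT /SpP gT; apply/SpP => u; rewrite mcoeffD => fgu.
have [fu|/fT//] := eqVneq (f@_u) 0.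
by apply: gT; rewrite fu add0r in fgu.
Qed.

Lemma SpZ (T : set G) (c : K) (f : A) : Sp T f -> Sp T (c *: f).
Proof.
move=> /SpP fT; apply/SpP => u; rewrite mcoeffZ => cfu; apply: fT.
by apply: contraNneq cfu => ->; rewrite mulr0.
Qed.

Variable I : set A.
Hypothesis hI : right_ideal I.

Lemma right_idealD f g : I f -> I g -> I (f + g).
Proof.
have [I0 IB _] := hI => If Ig; rewrite -[g]opprK; apply: (IB) => //.
by rewrite -sub0r; apply: IB.
Qed.

Lemma right_idealZ c f : I f -> I (c *: f).
Proof. by have [_ _ IM] := hI => If; rewrite ga_scaleEr; apply: IM. Qed.

(** The subspace [Sp T + I]; the witness [g] is the component in [I]. *)
Definition SpI (T : set G) : set A := [set f | exists2 g, I g & Sp T (f - g)]%classic.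

Lemma sub_SpI (T U : set G) : (T `<=` U)%classic -> (SpI T `<=` SpI U)%classic.
Proof. by move=> TU f [g Ig /(sub_Sp TU)]; exists g. Qed.

Lemma Sp_SpI (T : set G) : (Sp T `<=` SpI T)%classic.
Proof. by have [I0 _ _] := hI => f Tf; exists 0 => //; rewrite subr0. Qed.

Lemma ideal_SpI (T : set G) : (I `<=` SpI T)%classic.
Proof. by move=> f If; exists f => //; rewrite subrr; apply: Sp0. Qed.

Lemma SpID (T : set G) f g : SpI T f -> SpI T g -> SpI T (f + g).
Proof.
move=> [f' If Tf] [g' Ig Tg]; exists (f' + g'); first exact: right_idealD.
by rewrite opprD addrACA; apply: SpD.
Qed.

Lemma SpIZ (T : set G) c f : SpI T f -> SpI T (c *: f).
Proof.
move=> [g Ig Tg]; exists (c *: g); first exact: right_idealZ.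
by rewrite -scalerBr; apply: SpZ.
Qed.

Lemma SpI_sum (T : set G) (s : seq (K * G)) :
  (forall p, p \in s -> SpI T (ga_of K p.2)) ->
  SpI T (\sum_(p <- s) p.1 *: ga_of K p.2).
Proof.
move=> sT; rewrite big_seq; apply: (big_ind (SpI T)).
- exact/Sp_SpI/Sp0.
- exact: SpID.
- by move=> p /sT; apply: SpIZ.
Qed.

(** By linearity the span part can be checked on the elements of [T], and the part in [I] stays in
    [I] because the ideal is a right one. *)
Lemma SpI_mulr (T U : set G) (x : G) f :
  (forall u, T u -> SpI U (ga_of K (u * x)%g)) ->
  SpI T f -> SpI U (f * ga_of K x).
Proof.
have [_ _ IM] := hI => TU [g Ig [s sT fg]].
rewrite -(subrK g f) mulrDl fg; apply: SpID; last exact/ideal_SpI/IM.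
rewrite mulr_suml (eq_bigr (fun p => p.1 *: ga_of K (p.2 * x)%g)) => [|p _].
  rewrite -(big_map (fun p => (p.1, p.2 * x)%g) xpredT (fun p => p.1 *: ga_of K p.2)).
  by apply: SpI_sum => _ /mapP[p /sT/TU ? ->].
by rewrite -scalerAl; congr (_ *: _); rewrite [LHS]ga_mulUU mulr1.
Qed.

Lemma SpI_setT (T : set G) : (forall u, SpI T (ga_of K u)) -> forall f, SpI T f.
Proof.
move=> all f; have [s _ ->] : Sp setT f by apply/SpP.
exact: SpI_sum.
Qed.

End Span.

(** * The greedy transversal and its minimality *)

Section Greedy.
Variables (K : fieldType) (S : choiceType).
Local Notation F := (free_group S).
Variable le : rel F.
Hypothesis hle : exposure_order le.
Variable I : set (group_algebra K F).
Hypothesis hI : right_ideal I.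

Local Notation below T w := (T `&` [set v | le v w && (v != w)])%classic.

Definition greedy (T : set F) : Prop := forall w, T w <->
  (forall v : F, prefix v w -> v != w -> T v) /\ ~ SpI I (below T w) (ga_of K w).

Lemma greedy_exists : exists T, greedy T.
Proof.
have [wo pre] := hle.
(* Here [X] stands for the kept words strictly below [w]. Asking for prefixes in [X] rather than in
   [T] loses nothing, since an exposure order puts proper prefixes of [w] strictly below [w]. *)
pose P (w : F) (X : set F) :=
  (forall v : F, prefix v w -> v != w -> X v) /\ ~ SpI I X (ga_of K w).
have [T TP] := wf_rec_set P (well_order_wf wo).
exists T => w; rewrite TP /P; split=> -[Tp Tn]; split=> // v vw nvw.
  by have [] := Tp v vw nvw.
by split; [apply: Tp | rewrite /= pre].
Qed.

Variable T : set F.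
Hypothesis hT : greedy T.

Lemma greedy_prefix_closed : prefix_closed T.
Proof.
move=> u v Tv uv; have [Tp _] := (hT v).1 Tv.
by have [->//|] := eqVneq u v; apply: Tp.
Qed.

Lemma greedy_free : (Sp T `&` I = [set 0])%classic.
Proof.
have [wo _] := hle; have [I0 _ _] := hI.
apply/seteqP; split=> [f [Tf If]|_ ->] /=; last by split=> //; apply: Sp0.
apply: contrapT => /eqP f0.
have /(well_order_max wo)[w wf wmax] : (msupp f : seq F) != [::].
  apply: contraNneq f0 => f0; apply/eqP/malgP => u; rewrite mcoeff0.
  by apply: mcoeff_outdom; rewrite -[_ \in _]/(u \in (msupp f : seq F)) f0.
have fw : f@_w != 0 by rewrite mcoeff_neq0.
have Tw : T w by move/SpP: Tf; apply.
(* Normalising the leading coefficient of [f] to 1 leaves [w] minus an element of [I] supported on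
   kept words below [w], so [w] should have been rejected. *)
case: ((hT w).1 Tw) => _; apply; exists ((f@_w)^-1 *: f); first exact: right_idealZ.
apply/SpP => u; rewrite mcoeffB mcoeffZ mcoeffU.
have [<-|nwu] := eqVneq w u; first by rewrite mulr1n mulVf // subrr eqxx.
rewrite mulr0n sub0r oppr_eq0 mulf_eq0 negb_or => /andP[_ fu].
split; first by move/SpP: Tf; apply.
by rewrite /= eq_sym nwu wmax // -mcoeff_neq0.
Qed.

Lemma greedy_span u : SpI I T (ga_of K u).
Proof.
have sub w : SpI I (below T w) (ga_of K w) -> SpI I T (ga_of K w).
  by apply: sub_SpI => v [].
elim/fg_right_ind: u => [|u a IH].
  (* The empty word has no proper prefix, so only the span condition can reject it. *)
  have [T1|nT1] := pselect (T 1%g); first exact/(Sp_SpI hI)/Sp_ga_of.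
  apply: sub; apply: contrapT => n1; apply: nT1; apply/hT; split=> // v.
  rewrite prefixs0 => /eqP v1 /negP[]; exact/eqP/val_inj.
have -> : ga_of K (u * fg_letter a)%g = ga_of K u * ga_of K (fg_letter a).
  by rewrite [RHS]ga_mulUU mulr1.
apply: (SpI_mulr hI) IH => t Tt.
have [Tta|nTta] := pselect (T (t * fg_letter a)%g); first exact/(Sp_SpI hI)/Sp_ga_of.
have [/(greedy_prefix_closed Tt)//|eta] := fg_mul_letter t a.
(* Proper prefixes of the child [t * a] are prefixes of [t], hence kept. *)
apply: sub; apply: contrapT => nta; apply: nTta; apply/hT; split=> // v.
rewrite eta => vta nv; apply: greedy_prefix_closed Tt _.
apply: prefix_rcons_cases vta _.
by apply: contraNneq nv => ev; apply/eqP/val_inj; rewrite /= ev -eta.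
Qed.

Lemma greedy_schreier : schreier_transversal I T.
Proof.
split; [exact: greedy_prefix_closed | exact: greedy_free | move=> f].
have [_ _ IM] := hI; have [g Ig Tg] := SpI_setT hI greedy_span f.
exists (f - g); split=> //; exists (- g) => //.
by rewrite -scaleN1r; apply: right_idealZ.
Qed.

Lemma greedy_le_min U : schreier_transversal I U -> le_min le T U.
Proof.
move=> [Upre Ufree _]; have [wo pre] := hle.
have [->|TU] := pselect (T = U); [by left | right].
have [|m [[mTU mle] _]] := wo (mem (T `+` U)%classic).
  apply: contrapT => ne; apply: TU; apply/seteqP; split=> x xX;
    apply: contrapT => nx; apply: ne; exists x; rewrite in_setE; [left|right] => //.
exists m => //; apply: contrapT => nTm.
have Um : U m by move: mTU; rewrite in_setE => -[[]//|[]].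
have agree v : le v m -> v != m -> T v <-> U v.
  move=> vm nvm; split=> Xv; apply: contrapT => nXv; case/negP: nvm;
    apply/eqP/(well_order_anti wo); rewrite vm mle // in_setE; [left|right] => //.
apply: nTm; apply/hT; split=> [v vm nvm|].
  by apply/agree => //; [exact: pre | exact: Upre vm].
move=> [g Ig Tg].
have Ug : Sp (below U m) (ga_of K m - g).
  by apply: sub_Sp Tg => v [Tv /andP[vm nvm]]; split; [apply/agree | apply/andP].
(* Both [m] and [m - g] lie in [Sp U], hence so does [g], and [Sp U] meets [I] trivially. Then [m]
   itself lies in the span of words strictly below [m], which its coefficient 1 at [m] forbids. *)
have g0 : g = 0.
  suff : (Sp U `&` I)%classic g by rewrite Ufree.
  split=> //; rewrite -[g](subKr (ga_of K m)) -scaleN1r.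
  apply: SpD; first exact: Sp_ga_of.
  by apply: SpZ; apply: sub_Sp Ug => v [].
move: Ug; rewrite g0 subr0 => /SpP/(_ m).
by rewrite mcoeffUU oner_eq0 => /(_ isT)[_]; rewrite /= eqxx andbF.
Qed.

End Greedy.

Theorem theorem1p2 (K : fieldType) (S : finType)
    (le : rel (free_group S)) (hle : exposure_order le)
    (I : set (group_algebra K (free_group S))) (hI : right_ideal I) :
  exists T0 : set (free_group S),
    schreier_transversal I T0 /\
    forall T : set (free_group S), schreier_transversal I T -> le_min le T0 T.
Proof.
have [T hT] := greedy_exists hle I.
exists T; split; first exact: greedy_schreier hT.
by move=> U; apply: (greedy_le_min hle hT).
Qed.
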